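(* Let $\mu$ be a positive, finite, compactly supported Borel measure on $\mathbb{C}$ with infinite support, let $x\in\mathbb{C}$ and let $t>0$. Then $$\lim_{n\to\infty}\frac{p_n(z;\mu+t\delta_x)}{p_n(z;\mu)}=1$$ uniformly on compact subsets of $\overline{\mathbb{C}}\setminus\mathrm{ch}(\mu)$ if and only if $$\lim_{n\to\infty}\frac{|p_n(x;\mu)|^2}{\sum_{j=0}^{n-1}|p_j(x;\mu)|^2}=0.$$
   Context: $\overline{\mathbb{C}}$ is the Riemann sphere and $\delta_x$ is the unit point mass at $x$. For a positive, finite, compactly supported measure $\lambda$ with infinite support, $p_n(z;\lambda)$ is the degree-$n$ orthonormal polynomial of $\lambda$, with positive leading coefficient: $\int \overline{p_n(z;\lambda)}\,p_m(z;\lambda)\,d\lambda(z)=\delta_{nm}$. $\mathrm{ch}(\mu)$ is the convex hull of $\mathrm{supp}(\mu)$; all zeros of $p_n(\cdot;\mu)$ lie in $\mathrm{ch}(\mu)$. The quotient is regarded as analytic at $\infty$, with value the ratio of leading coefficients. *)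

(* Defs.v *)
From HB Require Import structures.
From mathcomp Require Import all_boot all_order all_algebra.
From mathcomp Require Import all_classical all_reals all_analysis.
From mathcomp Require Import complex.

Set Implicit Arguments.
Unset Strict Implicit.
Unset Printing Implicit Defensive.

Import Order.TTheory GRing.Theory Num.Theory.
Import numFieldNormedType.Exports.

Local Open Scope classical_set_scope.
Local Open Scope ring_scope.

(* The topology lives on [R[i]^o] (convertible to [R[i]]) and is the one given
   by the complex modulus. *)
Notation Cplx R := (complex R)^o.

Notation Csphere R := (one_point_compactification (Cplx R)).

Notation BorelC R := (g_sigma_algebraType (@open (Cplx R))).

Section Definitions.
Context {R : realType}.

(* [Rintegral] is finite-valued: it returns 0 on infinite integrals. It is only
   applied below to polynomial expressions against finite compactly supported
   measures, which are integrable. *)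
Definition Cintegral (mu : {measure set (BorelC R) -> \bar R}) (f : BorelC R -> R[i]) :
    R[i] :=
  (Rintegral mu setT (fun z => complex.Re (f z)) +i*
   Rintegral mu setT (fun z => complex.Im (f z)))%C.

Definition msupport (mu : {measure set (BorelC R) -> \bar R}) : set (Cplx R) :=
  [set z | forall U : set (Cplx R), open_nbhs z U -> (0 < mu U)%E].

(* Convexity is with respect to the real vector space structure of the complex
   plane, which [R[i]] carries under its alias [Rcomplex R]. *)
Definition convex_hull (A : set (Cplx R)) : set (Cplx R) :=
  smallest (@convex_set R (convex_lmodType (Rcomplex R))) A.

(* [0 < c] in [R[i]] says that [c] is real and positive. For a finite [mu] with
   compact infinite support, exactly one sequence satisfies this predicate. *)
Definition is_orthonormal_polys (mu : {measure set (BorelC R) -> \bar R})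
    (p : nat -> {poly R[i]}) : Prop :=
  (forall n, size (p n) = n.+1 /\ 0 < lead_coef (p n)) /\
  (forall n m, Cintegral mu (fun z => ((p n).[z])^* * (p m).[z])
               = (n == m)%:R).

(* The quotient [q / p] of two polynomials of the same degree, as a function on
   the Riemann sphere; [None] is the point at infinity. *)
Definition poly_ratio (q p : {poly R[i]}) (z : Csphere R) : Cplx R :=
  if z is Some w then q.[w] / p.[w] else lead_coef q / lead_coef p.

End Definitions.

(* Main.v *)
Require Import Defs.
From HB Require Import structures.
From mathcomp Require Import all_boot all_order all_algebra.
From mathcomp Require Import all_classical all_reals all_analysis.
From mathcomp Require Import measurable_realfun complex.
From mathcomp Require Import ring lra.

(** Rescale [q_n] to [Q_n = c_n q_n] with the leading coefficient of [p_n] and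
    put [A_n = Q_n - p_n], of degree less than [n]. Pairing with [p_j], [j < n],
    gives the coefficients of [A_n], whence, with [K_n = sum_(j < n) |p_j(x)|^2]
    and [E_n = t |p_n(x)|^2 / (1 + t K_n)],
      [c_n^2 = 1 + E_n]  and  [||A_n||^2 <= E_n]  in [L^2(mu)].
    The second limit of the theorem says that [E_n] tends to [0]; since the
    quotient at infinity is [1 / c_n], the first limit implies it. Conversely,
    suppose that [Re (w (s - z)) >= d > 0] and [|s - z| <= D] for all [s] in the
    support, with [|w| = 1]; such a [w] exists for every [z] outside the convex
    hull. With [S = (p_n(z) A_n - A_n(z) p_n) / (X - z)], the identities
    [<S, (X - z) S> = p_n(z) <S, A_n>] and [<p_n, (X - z) S> = - A_n(z)] give
    [d |A_n(z)| <= D |p_n(z)| ||A_n||], and [D / d] is bounded locally uniformly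
    on the complement of the convex hull in the sphere. *)

Set Implicit Arguments.
Unset Strict Implicit.
Unset Printing Implicit Defensive.

Import Order.TTheory GRing.Theory Num.Theory.
Import numFieldNormedType.Exports.

Local Open Scope classical_set_scope.
Local Open Scope ring_scope.

(** * Orthonormal polynomials for a Hermitian form *)

Section OrthonormalPolynomials.
Variables (C : numClosedFieldType) (ip : {poly C} -> {poly C} -> C).
Hypothesis ipD : forall f g h, ip f (g + h) = ip f g + ip f h.
Hypothesis ipZ : forall c f g, ip f (c *: g) = c * ip f g.
Hypothesis ipC : forall f g, ip g f = (ip f g)^*.
Hypothesis ip_ge0 : forall f, 0 <= ip f f.
Variable p : nat -> {poly C}.
Hypothesis size_p : forall n, size (p n) = n.+1.
Hypothesis ip_p : forall n m, ip (p n) (p m) = (n == m)%:R.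

Lemma ip0r f : ip f 0 = 0.
Proof. by rewrite -(scale0r 0) ipZ mul0r. Qed.

Lemma ip0l f : ip 0 f = 0.
Proof. by rewrite ipC ip0r rmorph0. Qed.

Lemma ipNr f g : ip f (- g) = - ip f g.
Proof. by rewrite -scaleN1r ipZ mulN1r. Qed.

Lemma ipBr f g h : ip f (g - h) = ip f g - ip f h.
Proof. by rewrite ipD ipNr. Qed.

Lemma ipDl f g h : ip (f + g) h = ip f h + ip g h.
Proof. by rewrite ipC ipD rmorphD /= -!ipC. Qed.

Lemma ipZl c f g : ip (c *: f) g = c^* * ip f g.
Proof. by rewrite ipC ipZ rmorphM /= -ipC. Qed.

Lemma ipNl f g : ip (- f) g = - ip f g.
Proof. by rewrite ipC ipNr rmorphN /= -ipC. Qed.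

Lemma ip_sumr f n (g : 'I_n -> {poly C}) :
  ip f (\sum_j g j) = \sum_j ip f (g j).
Proof. exact: (big_morph (ip f) (ipD f) (ip0r f)). Qed.

Lemma lead_p_neq0 n : (p n)`_n != 0.
Proof.
have := lead_coef_eq0 (p n); rewrite lead_coefE size_p /= => ->.
by rewrite -size_poly_eq0 size_p.
Qed.

(** Induction on the degree bound: subtracting the multiple of [p n] that cancels the coefficient of
    index [n] lowers the size, and orthonormality identifies the coefficients. *)
Lemma orthonormal_expansion n (f : {poly C}) : (size f <= n)%N ->
  f = \sum_(j < n) ip (p j) f *: p j.
Proof.
elim: n f => [|n IHn] f sf.
  by rewrite big_ord0; apply/eqP; rewrite -size_poly_leq0.
pose b := f`_n / (p n)`_n; pose g := f - b *: p n.
have sg : (size g <= n)%N.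
  apply/leq_sizeP => j; rewrite leq_eqVlt => /predU1P[<-|lt_nj].
    by rewrite coefB coefZ divfK ?lead_p_neq0 ?subrr.
  rewrite coefB coefZ (leq_sizeP _ _ sf) // nth_default ?size_p //.
  by rewrite mulr0 subrr.
have fE : f = g + b *: p n by rewrite subrK.
have ip_jf j : ip (p j) f = ip (p j) g + b * (j == n)%:R.
  by rewrite {1}fE ipD ipZ ip_p.
have ip_ng : ip (p n) g = 0.
  rewrite (IHn _ sg) ip_sumr big1 // => j _.
  by rewrite ipZ ip_p gtn_eqF ?mulr0.
rewrite big_ord_recr /= ip_jf ip_ng eqxx mulr1 add0r {1}fE.
congr (_ + _); rewrite {1}(IHn _ sg); apply: eq_bigr => j _.
by rewrite ip_jf ltn_eqF // mulr0 addr0.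
Qed.

Lemma ip_lower_degreer n (f : {poly C}) : (size f <= n)%N -> ip (p n) f = 0.
Proof.
move=> sf; rewrite (orthonormal_expansion sf) ip_sumr big1 // => j _.
by rewrite ipZ ip_p gtn_eqF ?mulr0.
Qed.

Lemma ip_lower_degreel n (f : {poly C}) : (size f <= n)%N -> ip f (p n) = 0.
Proof. by move=> sf; rewrite ipC ip_lower_degreer ?rmorph0. Qed.

Lemma parseval n (f : {poly C}) : (size f <= n)%N ->
  ip f f = \sum_(j < n) `|ip (p j) f| ^+ 2.
Proof.
move=> sf; rewrite {2}(orthonormal_expansion sf) ip_sumr; apply: eq_bigr => j _.
by rewrite ipZ [ip f _]ipC normCK.
Qed.

(** Definiteness comes from having an orthonormal polynomial of every degree: by Parseval all
    coefficients of [f] in that basis vanish. *)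
Lemma ip_eq0 f : ip f f = 0 -> f = 0.
Proof.
move=> f0; rewrite (orthonormal_expansion (leqnn (size f))) big1 // => j _.
suff -> : ip (p j) f = 0 by rewrite scale0r.
apply/eqP; rewrite -normr_eq0 -sqrf_eq0.
move: f0; rewrite (parseval (leqnn (size f))) => /eqP.
rewrite psumr_eq0 => [|i _]; last exact: exprn_ge0.
by move=> /allP/(_ j)/(_ (mem_index_enum _)).
Qed.

Lemma ip_cauchy_schwarz f g : `|ip f g| ^+ 2 <= ip f f * ip g g.
Proof.
have [f0|f_neq0] := eqVneq (ip f f) 0.
  by rewrite (ip_eq0 f0) ip0l normr0 expr0n /= ip0l mul0r.
have f_gt0 : 0 < ip f f by rewrite lt_def f_neq0 ip_ge0.
(* The square norm of this vector is [<f, f>] times the difference of the two sides of the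
   inequality. *)
have := ip_ge0 (ip f f *: g - ip f g *: f).
have fr : (ip f f)^* = ip f f by apply: geC0_conj.
rewrite ipBr !ipZ !ipDl !ipNl !ipZl fr.
have -> : ip f f * (ip f f * ip g g - (ip f g)^* * ip f g) -
   ip f g * (ip f f * ip g f - (ip f g)^* * ip f f) =
   ip f f * (ip f f * ip g g - `|ip f g| ^+ 2).
  by rewrite normCK [ip g f]ipC; ring.
by rewrite pmulr_rge0 // subr_ge0.
Qed.

Section Separated.
Variables (z d D : C).
Hypothesis d_gt0 : 0 < d.
Hypothesis D_ge0 : 0 <= D.
(** For the form of a measure, [shift_ge] and [shift_le] hold when every [s] in the support
    satisfies [Re (w (s - z)) >= d] for one fixed [w] with [|w| <= 1], and [|s - z| <= D]. *)
Hypothesis shift_ge : forall f, d * ip f f <= `|ip f (('X - z%:P) * f)|.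
Hypothesis shift_le : forall f,
  ip (('X - z%:P) * f) (('X - z%:P) * f) <= D ^+ 2 * ip f f.

(** If [p n = S (X - z)], then [<S, (X - z) S> = <S, p n> = 0] since [S] has smaller degree, and
    [shift_ge] forces [S = 0]. *)
Lemma orthonormal_horner_neq0 n : (p n).[z] != 0.
Proof.
apply/negP => /factor_theorem[S pE].
have S_neq0 : S != 0.
  by apply/eqP => S0; have := size_p n; rewrite pE S0 mul0r size_poly0.
have sS : (size S <= n)%N.
  have := size_p n.
  by rewrite pE size_Mmonic ?monicXsubC // size_XsubC addn2 => -[->].
have := shift_ge S; rewrite [_ * S]mulrC -pE ip_lower_degreel // normr0.
rewrite pmulr_rle0 // => S_le0.
by case/eqP: S_neq0; apply/ip_eq0/le_anti; rewrite S_le0 ip_ge0.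
Qed.

(* The polynomial [S = (p_n(z) A - A(z) p_n) / (X - z)] has degree less than
   [n], so [p_n] disappears from [<S, (X - z) S>], while pairing [(X - z) S]
   with [p_n] recovers [A(z)]. *)
Lemma horner_low_bound n (A : {poly C}) : (size A <= n)%N ->
  d ^+ 2 * `|A.[z]| ^+ 2 <= D ^+ 2 * (`|(p n).[z]| ^+ 2 * ip A A).
Proof.
move=> sA; pose F := (p n).[z] *: A - A.[z] *: p n.
have /factor_theorem[S FE] : root F z by rewrite /root !hornerE mulrC subrr.
have sS : (size S <= n)%N.
  have [->|S_neq0] := eqVneq S 0; first by rewrite size_poly0.
  have : (size F <= n.+1)%N.
    rewrite (leq_trans (size_polyD _ _)) // geq_max size_polyN.
    rewrite !(leq_trans (size_scale_leq _ _)) ?size_p //.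
    exact: leq_trans sA _.
  by rewrite FE size_Mmonic ?monicXsubC // size_XsubC addn2.
rewrite mulrC in FE.
have SF : ip S (('X - z%:P) * S) = (p n).[z] * ip S A.
  by rewrite -FE ipBr !ipZ ip_lower_degreel // mulr0 subr0.
have pF : ip (p n) (('X - z%:P) * S) = - A.[z].
  by rewrite -FE ipBr !ipZ ip_lower_degreer // ip_p eqxx mulr0 mulr1 sub0r.
have bound_A : `|A.[z]| ^+ 2 <= D ^+ 2 * ip S S.
  rewrite -normrN -pF (le_trans (ip_cauchy_schwarz _ _)) //.
  by rewrite ip_p eqxx mul1r.
have bound_S : d ^+ 2 * ip S S <= `|(p n).[z]| ^+ 2 * ip A A.
  have [->|S_neq0] := eqVneq (ip S S) 0.
    by rewrite mulr0 mulr_ge0 ?exprn_ge0.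
  have S_gt0 : 0 < ip S S by rewrite lt_def S_neq0 ip_ge0.
  have := shift_ge S; rewrite SF normrM => le1.
  have : (d * ip S S) ^+ 2 <= (`|(p n).[z]| * `|ip S A|) ^+ 2.
    by rewrite lerXn2r // nnegrE ?mulr_ge0 // ltW.
  rewrite !exprMn => /le_trans/(_ (ler_wpM2l (exprn_ge0 2 (normr_ge0 _))
    (ip_cauchy_schwarz S A))).
  by rewrite [ip S S * ip A A]mulrC [ip S S ^+ 2]expr2 !mulrA ler_pM2r.
apply: le_trans (ler_wpM2l (exprn_ge0 2 (ltW d_gt0)) bound_A) _.
rewrite mulrCA; apply: ler_wpM2l => //; exact: exprn_ge0.
Qed.

End Separated.

End OrthonormalPolynomials.

(** * Adding a point mass *)

Section PointMass.
Variables (C : numClosedFieldType) (ip : {poly C} -> {poly C} -> C).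
Hypothesis ipD : forall f g h, ip f (g + h) = ip f g + ip f h.
Hypothesis ipZ : forall c f g, ip f (c *: g) = c * ip f g.
Hypothesis ipC : forall f g, ip g f = (ip f g)^*.
Variables p q : nat -> {poly C}.
Hypothesis size_p : forall n, size (p n) = n.+1.
Hypothesis size_q : forall n, size (q n) = n.+1.
Hypothesis lead_p_gt0 : forall n, 0 < lead_coef (p n).
Hypothesis lead_q_gt0 : forall n, 0 < lead_coef (q n).
Hypothesis ip_p : forall n m, ip (p n) (p m) = (n == m)%:R.
Variables (x t : C).
Hypothesis t_gt0 : 0 < t.

(** The form of the measure with mass [t] added at [x]. *)
Let ipx f g := ip f g + t * (f.[x]^* * g.[x]).

Hypothesis ip_q : forall n m, ipx (q n) (q m) = (n == m)%:R.

(** These four are [c_n], [A_n], [K_n] and [E_n] of the introduction; [K_n] is the reciprocal of a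
    Christoffel function at [x]. *)
Definition lead_ratio n := lead_coef (p n) / lead_coef (q n).
Definition low_diff n := lead_ratio n *: q n - p n.
Definition christoffel_sum n := \sum_(j < n) `|(p j).[x]| ^+ 2.
Definition mass_gap n := t * `|(p n).[x]| ^+ 2 / (1 + t * christoffel_sum n).

Let ipxD f g h : ipx f (g + h) = ipx f g + ipx f h.
Proof. by rewrite /ipx ipD hornerD; ring. Qed.

Let ipxZ c f g : ipx f (c *: g) = c * ipx f g.
Proof. by rewrite /ipx ipZ hornerZ; ring. Qed.

Let ipxC f g : ipx g f = (ipx f g)^*.
Proof.
rewrite /ipx [ip g f]ipC !rmorphD !rmorphM /= conjCK (geC0_conj (ltW t_gt0)).
by rewrite [f.[x] * _]mulrC.
Qed.

Lemma lead_ratio_gt0 n : 0 < lead_ratio n.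
Proof. exact: divr_gt0. Qed.

Lemma size_low_diff n : (size (low_diff n) <= n)%N.
Proof.
apply/leq_sizeP => j; rewrite leq_eqVlt => /predU1P[<-|lt_nj].
  have := lead_coefE (q n); have := lead_coefE (p n).
  rewrite size_p size_q /= coefB coefZ => <- <-.
  by rewrite divfK ?subrr // gt_eqF.
by rewrite coefB coefZ !nth_default ?size_p ?size_q // mulr0 subrr.
Qed.

Lemma christoffel_sum_ge0 n : 0 <= christoffel_sum n.
Proof. by apply: sumr_ge0 => j _; exact: exprn_ge0. Qed.

Lemma one_plus_christoffel_gt0 n : 0 < 1 + t * christoffel_sum n.
Proof. by rewrite ltr_pwDl // mulr_ge0 ?christoffel_sum_ge0 // ltW. Qed.

Lemma mass_gap_ge0 n : 0 <= mass_gap n.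
Proof.
apply: divr_ge0; last exact/ltW/one_plus_christoffel_gt0.
by rewrite mulr_ge0 ?exprn_ge0 // ltW.
Qed.

Let Q n := lead_ratio n *: q n.

Let QE n : Q n = p n + low_diff n.
Proof. by rewrite addrC subrK. Qed.

(** [Q n] is orthogonal to [p j] for [ipx], and [p n] is orthogonal to [p j] for [ip]; only the mass
    term remains. *)
Let ip_low_diff n j : (j < n)%N ->
  ip (p j) (low_diff n) = - (t * (p j).[x]^* * (Q n).[x]).
Proof.
move=> lt_jn.
have : ipx (p j) (Q n) = 0.
  by rewrite ipxZ (ip_lower_degreel ipxD ipxZ ipxC size_q ip_q) ?mulr0 // size_p.
rewrite /ipx QE ipD ip_p ltn_eqF // add0r -QE mulrA => /eqP.
by rewrite addr_eq0 => /eqP.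
Qed.

(** Evaluating the expansion of [A_n] at [x] gives [A_n(x) = - t K_n Q_n(x)], a linear equation for
    [Q_n(x) = p_n(x) + A_n(x)]. *)
Let Qx n : (Q n).[x] = (p n).[x] / (1 + t * christoffel_sum n).
Proof.
have E : (low_diff n).[x] = - (t * christoffel_sum n * (Q n).[x]).
  rewrite {1}(orthonormal_expansion ipD ipZ size_p ip_p (size_low_diff n)).
  rewrite horner_sum /christoffel_sum mulr_sumr mulr_suml -sumrN.
  apply: eq_bigr => j _; rewrite hornerZ ip_low_diff // normCK; ring.
have {}E : (Q n).[x] * (1 + t * christoffel_sum n) = (p n).[x].
  by rewrite mulrDr mulr1 {1}QE hornerD E; ring.
by rewrite -E mulfK // gt_eqF ?one_plus_christoffel_gt0.
Qed.

(** The left side is the square norm of [Q n] for [ipx]. As [A_n] has lower degree, it equals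
    [ipx (p n) (Q n)], that is [1 + t conj(p_n(x)) Q_n(x)]. *)
Lemma lead_ratio_sqr n : lead_ratio n ^+ 2 = 1 + mass_gap n.
Proof.
have c_real : (lead_ratio n)^* = lead_ratio n.
  exact/geC0_conj/ltW/lead_ratio_gt0.
have -> : lead_ratio n ^+ 2 = ipx (Q n) (Q n).
  by rewrite ipxZ (ipZl ipxZ ipxC) ip_q eqxx c_real mulr1.
rewrite {1}QE (ipDl ipxD ipxC).
have -> : ipx (low_diff n) (Q n) = 0.
  rewrite ipxZ (ip_lower_degreel ipxD ipxZ ipxC size_q ip_q) ?mulr0 //.
  exact: size_low_diff.
rewrite addr0 /ipx {1}QE ipD ip_p eqxx.
rewrite (ip_lower_degreer ipD ipZ size_p ip_p (size_low_diff n)) addr0.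
by rewrite Qx /mass_gap normCK mulr1n; ring.
Qed.

(** Parseval gives the exact value [t^2 |Q_n(x)|^2 K_n], which is [E_n] times
    [t K_n / (1 + t K_n) <= 1]. *)
Lemma ip_low_diff_le n : ip (low_diff n) (low_diff n) <= mass_gap n.
Proof.
rewrite (parseval ipD ipZ ipC size_p ip_p (size_low_diff n)).
have den := one_plus_christoffel_gt0 n.
have -> : \sum_(j < n) `|ip (p j) (low_diff n)| ^+ 2 =
    mass_gap n * (t * christoffel_sum n / (1 + t * christoffel_sum n)).
  transitivity (t ^+ 2 * `|(Q n).[x]| ^+ 2 * christoffel_sum n).
    rewrite mulr_sumr; apply: eq_bigr => j _.
    rewrite ip_low_diff // normrN !normrM norm_conjC (ger0_norm (ltW t_gt0)).
    by ring.
  rewrite Qx normrM normfV (ger0_norm (ltW den)) /mass_gap.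
  by field; rewrite gt_eqF.
rewrite ler_piMr ?mass_gap_ge0 // ler_pdivrMr // mul1r.
by rewrite ler_wpDl.
Qed.

(** The constant [p 0] is nonzero, so the denominator in the second limit of the theorem is positive
    from [n = 1] on; at [n = 0] it is an empty sum. *)
Lemma christoffel_sum1_gt0 : 0 < christoffel_sum 1.
Proof.
rewrite /christoffel_sum big_ord1 exprn_gt0 // normr_gt0.
have /size_poly1P[c c_neq0 ->] : size (p 0) == 1 by rewrite size_p.
by rewrite hornerC.
Qed.

Lemma christoffel_sum1_le n : (0 < n)%N -> christoffel_sum 1 <= christoffel_sum n.
Proof.
case: n => // n _; rewrite /christoffel_sum big_ord1 big_ord_recl lerDl.
by apply: sumr_ge0 => j _; exact: exprn_ge0.
Qed.

(** The two quantities differ by the factor [1 + 1 / (t K_n)], which lies between [1] and its value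
    at [n = 1]. With [le_mass_gap] this makes them tend to [0] together. *)
Lemma mass_gap_le n : (0 < n)%N ->
  mass_gap n <= `|(p n).[x]| ^+ 2 / christoffel_sum n.
Proof.
move=> n_gt0.
have K_gt0 := lt_le_trans christoffel_sum1_gt0 (christoffel_sum1_le n_gt0).
rewrite /mass_gap ler_pdivrMr ?one_plus_christoffel_gt0 //.
have -> : `|(p n).[x]| ^+ 2 / christoffel_sum n * (1 + t * christoffel_sum n) =
    t * `|(p n).[x]| ^+ 2 + `|(p n).[x]| ^+ 2 / christoffel_sum n.
  by field; rewrite gt_eqF.
by rewrite lerDl divr_ge0 ?exprn_ge0 // ltW.
Qed.

Lemma le_mass_gap n : (0 < n)%N ->
  `|(p n).[x]| ^+ 2 / christoffel_sum n <=
  (1 + (t * christoffel_sum 1)^-1) * mass_gap n.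
Proof.
move=> n_gt0; have K1_gt0 := christoffel_sum1_gt0.
have K_gt0 := lt_le_trans K1_gt0 (christoffel_sum1_le n_gt0).
have den := one_plus_christoffel_gt0 n.
have -> : `|(p n).[x]| ^+ 2 / christoffel_sum n =
    (1 + (t * christoffel_sum n)^-1) * mass_gap n.
  by rewrite /mass_gap; field; rewrite !gt_eqF.
rewrite ler_wpM2r ?mass_gap_ge0 // lerD2l lef_pV2 ?posrE ?mulr_gt0 //.
by rewrite ler_pM2l // christoffel_sum1_le.
Qed.

End PointMass.

(** * Separation in the plane *)

(** First-order condition for a quadratic function on [[0, 1]] that is smallest at the left end,
    where its slope is [2 a]. *)
Lemma quadratic_ge_slope (R : realFieldType) (a b : R) : 0 <= b ->
  (forall h, 0 <= h <= 1 -> 0 <= h * (2 * a + h * b)) -> 0 <= a.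
Proof.
move=> b_ge0 H; rewrite leNgt; apply/negP => a_lt0.
have ba_gt0 : 0 < b - a by lra.
(* At this [h] in []0, 1]] the factor [2 a + h b] equals [a (b - 2 a) / (b - a) < 0]. *)
pose h := - a / (b - a).
have h_gt0 : 0 < h by rewrite divr_gt0 // oppr_gt0.
have hE : h * (b - a) = - a by rewrite divfK // gt_eqF.
have h_le1 : h <= 1 by rewrite ler_pdivrMr // mul1r; lra.
have := H h; rewrite (ltW h_gt0) h_le1 => /(_ isT).
by rewrite pmulr_rge0 //; nra.
Qed.

Section PlanarSeparation.
Variables (R : realType) (A H : set (R * R)).
Hypothesis A_compact : compact A.
Hypothesis A_neq0 : A !=set0.
Hypothesis subAH : A `<=` H.
Hypothesis H_convex : forall u v (l : R), H u -> H v -> 0 <= l <= 1 ->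
  H (l * u.1 + (1 - l) * v.1, l * u.2 + (1 - l) * v.2).
Hypothesis H0 : ~ H (0, 0).

Let nsq (u : R * R) := u.1 ^+ 2 + u.2 ^+ 2.
Let seg (u v : R * R) (l : R) :=
  (l * u.1 + (1 - l) * v.1, l * u.2 + (1 - l) * v.2).

Let nsq_gt0 u : H u -> 0 < nsq u.
Proof.
move=> Hu; rewrite lt_def addr_ge0 ?sqr_ge0 // andbT.
apply/negP; rewrite paddr_eq0 ?sqr_ge0 // !sqrf_eq0.
case: u Hu => u1 u2 /= Hu /andP[/eqP u10 /eqP u20].
by apply: H0; rewrite -{1}u10 -u20.
Qed.

(** [H] is convex but perhaps not closed, so the minimum is taken over the segments with ends in
    [A], which form a compact family. *)
Let segment_min : exists u v l, [/\ A u, A v, 0 <= l <= 1 &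
  forall u' v' l', A u' -> A v' -> 0 <= l' <= 1 ->
    nsq (seg u v l) <= nsq (seg u' v' l')].
Proof.
have [a Aa] := A_neq0.
pose T : Type := ((R * R) * (R * R) * R)%type.
pose K := (A `*` A) `*` `[0%R : R, 1%R]%classic.
have K_compact : compact K.
  by apply: compact_setX; [exact: compact_setX|exact: segment_compact].
have K_neq0 : K !=set0.
  by exists ((a, a), 0); rewrite /K /= in_itv /= lexx ler01.
pose f (w : T) : R := nsq (seg w.1.1 w.1.2 w.2).
have f_cont : {within K, continuous f}.
  apply: continuous_subspaceT => w.
  have c1 : continuous (fun w : T => w.2) by move=> ?; exact: cvg_snd.
  have c11 : continuous (fun w : T => w.1) by move=> ?; exact: cvg_fst.
  rewrite /f /nsq /seg /=.
  have cu : continuous (fun w : T => w.1.1).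
    by move=> ?; apply: cvg_comp; [exact: c11|exact: cvg_fst].
  have cv : continuous (fun w : T => w.1.2).
    by move=> ?; apply: cvg_comp; [exact: c11|exact: cvg_snd].
  have cu1 : continuous (fun w : T => w.1.1.1).
    by move=> ?; apply: cvg_comp; [exact: cu|exact: cvg_fst].
  have cu2 : continuous (fun w : T => w.1.1.2).
    by move=> ?; apply: cvg_comp; [exact: cu|exact: cvg_snd].
  have cv1 : continuous (fun w : T => w.1.2.1).
    by move=> ?; apply: cvg_comp; [exact: cv|exact: cvg_fst].
  have cv2 : continuous (fun w : T => w.1.2.2).
    by move=> ?; apply: cvg_comp; [exact: cv|exact: cvg_snd].
  have c1' : continuous (fun w : T => 1 - w.2).
    by move=> ?; apply: cvgB; [exact: cvg_cst|exact: c1].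
  have cs (h : T -> R) : continuous h ->
      continuous (fun w => h w ^+ 2).
    by move=> ch ?; exact: (continuous_comp (ch _) (@exprn_continuous _ 2 _)).
  have cl (h k : T -> R) : continuous h -> continuous k ->
      continuous (fun w : T => w.2 * h w + (1 - w.2) * k w).
    move=> ch ck ?; apply: cvgD; apply: cvgM;
      [exact: c1|exact: ch|exact: c1'|exact: ck].
  by apply: cvgD; [exact: (cs _ (cl _ _ cu1 cv1))|exact: (cs _ (cl _ _ cu2 cv2))].
have [c cK fmin] := compact_EVT_min K_neq0 K_compact f_cont.
move: cK; rewrite inE => -[[/= c1 c2] c3].
exists c.1.1, c.1.2, c.2; split => //.
move=> u v l Au Av l01; apply: (fmin ((u, v), l)); rewrite inE.
by split => //=; rewrite in_itv.
Qed.

(* Let [m] be the point of smallest modulus on the segments joining two points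
   of [A]. If [s] in [A] had [<m, s> <= 0], the segment from [s] to a suitable
   end of the segment carrying [m] would meet the line [R m] at a point [r m]
   with [r < 1], hence with [r <= -1] by minimality, and [0] would lie between
   [r m] and [m]. *)
Lemma planar_separation :
  exists m : R * R, forall s, A s -> 0 < m.1 * s.1 + m.2 * s.2.
Proof.
have [u [v [l [Au Av /andP[l_ge0 l_le1] minm]]]] := segment_min.
exists (seg u v l) => s As; set m := seg u v l in minm *.
have Hm : H m by apply: H_convex; rewrite ?l_ge0 //; exact: subAH.
have m_gt0 := nsq_gt0 Hm.
rewrite ltNge; apply/negP => ms_le0.
pose dot (a b : R * R) := a.1 * b.1 + a.2 * b.2.
pose crs (a b : R * R) := a.1 * b.2 - a.2 * b.1.
(* If a point [e] of [A] itself attains the minimum, moving from [e] towards [k] cannot decrease the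
   modulus. *)
have slope_end e k : A e -> A k -> nsq e = nsq m -> nsq e <= dot e k.
  move=> Ae Ak em.
  suff : 0 <= dot e (k.1 - e.1, k.2 - e.2) by rewrite /dot /nsq /=; lra.
  apply: (@quadratic_ge_slope _ _ (nsq (k.1 - e.1, k.2 - e.2))).
    by rewrite addr_ge0 ?sqr_ge0.
  move=> h h01; have := minm k e h Ak Ae h01.
  by rewrite -em /nsq /seg /dot /=; lra.
(* Moving [m] towards [u], then towards [v]: if [m] is interior to its segment, the two conditions
   make [m] orthogonal to [u - v]. *)
have slope_u : 0 <= (1 - l) * dot m (u.1 - v.1, u.2 - v.2).
  apply: (@quadratic_ge_slope _ _ ((1 - l) ^+ 2 * nsq (u.1 - v.1, u.2 - v.2))).
    by rewrite mulr_ge0 ?addr_ge0 ?sqr_ge0.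
  move=> h h01; have := minm u v (l + h * (1 - l)) Au Av.
  have -> : 0 <= l + h * (1 - l) <= 1 by nra.
  move=> /(_ isT); rewrite /m /nsq /seg /dot /=; nra.
have slope_v : 0 <= - l * dot m (u.1 - v.1, u.2 - v.2).
  apply: (@quadratic_ge_slope _ _ (l ^+ 2 * nsq (u.1 - v.1, u.2 - v.2))).
    by rewrite mulr_ge0 ?addr_ge0 ?sqr_ge0.
  move=> h h01; have := minm u v (l - h * l) Au Av.
  have -> : 0 <= l - h * l <= 1 by nra.
  move=> /(_ isT); rewrite /m /nsq /seg /dot /=; nra.
(* The suitable end [e] has orthogonal projection [m] on the line [R m] and does not lie strictly on
   the same side of this line as [s]. *)
have [e [Ae me ce]] : exists e, [/\ A e, dot m e = nsq m & crs m e * crs m s <= 0].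
  have [l0|l_neq0] := eqVneq l 0.
    by exists v; split; rewrite // /m /seg l0 /dot /crs /nsq /=; lra.
  have [l1|l_neq1] := eqVneq l 1.
    by exists u; split; rewrite // /m /seg l1 /dot /crs /nsq /=; lra.
  have l_gt0 : 0 < l by rewrite lt_def l_neq0.
  have l_lt1 : 0 < 1 - l by rewrite subr_gt0 lt_neqAle l_neq1.
  have crs0 : l * crs m u + (1 - l) * crs m v = 0.
    by rewrite /crs /m /seg /=; ring.
  have dot0 : l * dot m u + (1 - l) * dot m v = nsq m.
    by rewrite /dot /nsq /m /seg /=; ring.
  have dot_uv : dot m u = dot m v.
    move: slope_u slope_v; rewrite pmulr_rge0 // mulNr oppr_ge0 pmulr_rle0 //.
    by rewrite /dot /=; lra.
  have [cu|cu] := lerP (crs m u * crs m s) 0.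
    by exists u; split => //; rewrite -dot0 -dot_uv; ring.
  exists v; split => //; first by rewrite -dot0 dot_uv; ring.
  have E : (1 - l) * (crs m v * crs m s) = - (l * (crs m u * crs m s)).
    by move: crs0 => /(congr1 (fun y => y * crs m s)); lra.
  by rewrite -(pmulr_rle0 _ l_lt1) E oppr_le0 mulr_ge0 // ltW.
have lagrange a b : nsq a * nsq b = dot a b ^+ 2 + crs a b ^+ 2.
  by rewrite /nsq /dot /crs; ring.
(* If [e] is on the line [R m], then [e = m] lies in [A], and [slope_end] contradicts
   [<m, s> <= 0]. *)
have [ce0|ce_neq0] := eqVneq (crs m e) 0.
  have em : nsq e = nsq m.
    apply: (mulfI (lt0r_neq0 m_gt0)).
    by rewrite lagrange ce0 me; ring.
  have : nsq (e.1 - m.1, e.2 - m.2) = 0.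
    by move: em me; rewrite /nsq /dot /=; lra.
  rewrite /nsq /= => /eqP; rewrite paddr_eq0 ?sqr_ge0 // !sqrf_eq0 !subr_eq0.
  move=> /andP[/eqP e1 /eqP e2].
  have := slope_end e s Ae As em; rewrite em /dot e1 e2.
  by rewrite leNgt (le_lt_trans ms_le0).
set c := crs m e in ce ce_neq0; set k := crs m s in ce.
have c2_gt0 : 0 < c ^+ 2 by rewrite lt_def sqrf_eq0 ce_neq0 sqr_ge0.
have D_gt0 : 0 < (k - c) ^+ 2.
  by rewrite (_ : _ ^+ 2 = k ^+ 2 + c ^+ 2 - 2 * (c * k)); [nra|ring].
have D_neq0 : k - c != 0 by rewrite -sqrf_eq0 gt_eqF.
(* This is [k / (k - c)], the root of [r c + (1 - r) k = 0], where the segment meets the line [R m].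
   The squared denominator shows its sign, as [c k <= 0]. *)
pose r := k * (k - c) / (k - c) ^+ 2.
have r1E : 1 - r = (c ^+ 2 - c * k) / (k - c) ^+ 2 by rewrite /r; field.
have r_ge0 : 0 <= r by rewrite divr_ge0 ?(ltW D_gt0) //; nra.
have r_lt1 : 0 < 1 - r by rewrite r1E divr_gt0 //; lra.
pose g := seg e s r.
have Hg : H g by apply: H_convex; [exact: subAH|exact: subAH|lra].
have crs_g : crs m g = 0.
  transitivity (r * c + (1 - r) * k).
    by rewrite /crs /g /seg /c /k /crs /=; ring.
  by rewrite /r; field.
have dot_g : dot m g = r * nsq m + (1 - r) * dot m s.
  by rewrite -me /dot /g /seg /=; ring.
have dot_g_lt : dot m g < nsq m by rewrite dot_g /dot; nra.
(* [g] is a multiple of [m] of modulus at least that of [m], and [dot_g_lt] excludes the multiples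
   by a factor at least [1]. *)
have dot_g_le : dot m g <= - nsq m.
  have min_g : nsq m <= nsq g by apply: minm => //; lra.
  have := lagrange m g; rewrite crs_g; nra.
(* The parameter at which the segment between [m] and [g] passes through the origin. *)
pose th := - dot m g / (nsq m - dot m g).
have den_gt0 : 0 < nsq m - dot m g by lra.
have th01 : 0 <= th <= 1.
  apply/andP; split; first by apply: divr_ge0; lra.
  by rewrite ler_pdivrMr // mul1r; lra.
have Hw : H (seg m g th) by exact: H_convex.
have := nsq_gt0 Hw; rewrite -(pmulr_rgt0 _ m_gt0) lagrange.
have -> : crs m (seg m g th) = (1 - th) * crs m g by rewrite /crs /seg /=; ring.
have -> : dot m (seg m g th) = th * nsq m + (1 - th) * dot m g.
  by rewrite /dot /seg /nsq /=; ring.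
rewrite crs_g mulr0 [X in X ^+ 2 + _](_ : _ = 0) ?expr0n ?addr0 ?ltxx //.
by rewrite /th; field; rewrite gt_eqF.
Qed.
End PlanarSeparation.

(** * Continuity of real-valued functions *)

Section RealValuedContinuity.
Variables (T : topologicalType) (R : realType) (f g : T -> R).
Hypotheses (f_cont : continuous f) (g_cont : continuous g).

Lemma continuous_subr_cst (a : R) : continuous (fun s => f s - a).
Proof. by move=> s; apply: cvgB; [exact: f_cont|exact: cvg_cst]. Qed.

Lemma continuous_addr : continuous (fun s => f s + g s).
Proof. by move=> s; apply: cvgD; [exact: f_cont|exact: g_cont]. Qed.

Lemma continuous_oppr : continuous (fun s => - f s).
Proof. by move=> s; apply: cvgN; exact: f_cont. Qed.

Lemma continuous_mulr : continuous (fun s => f s * g s).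
Proof. by move=> s; apply: cvgM; [exact: f_cont|exact: g_cont]. Qed.

Lemma continuous_linear2 (a b : R) : continuous (fun s => a * f s + b * g s).
Proof.
move=> s; apply: cvgD; apply: cvgM; try exact: cvg_cst.
  exact: f_cont.
exact: g_cont.
Qed.

Lemma continuous_pair : continuous (fun s => (f s, g s)).
Proof.
move=> s; exact: (cvg_pair (@f_cont s) (@g_cont s)).
Qed.

End RealValuedContinuity.

(** * Real coordinates and separation in the complex plane *)

Section ComplexPlane.
Variable R : realType.
Implicit Types (z w : R[i]).

Let normci : `|'i%C : R[i]| = 1.
Proof. by rewrite normc_def /= expr0n expr1n add0r sqrtr1. Qed.

Lemma normc_Im z : (`|complex.Im z|%:C <= `|z|)%C.
Proof.
have := normc_ge_Re (z * 'i%C).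
by rewrite ReiNIm normrN normrM normci mulr1.
Qed.

Lemma near_dist_lt (z : Cplx R) (e : R) : 0 < e ->
  \forall w \near z, (`|z - w| < e%:C)%C.
Proof.
move=> e0; have FF : Filter (nbhs z) by exact: nbhs_filter.
by apply: (@cvgr_dist_lt _ (Cplx R) _ (nbhs z) FF id z (@cvg_id _ _)); rewrite ltcR.
Qed.

Lemma continuous_Re : continuous (@complex.Re R : Cplx R -> R).
Proof.
move=> z; have FF : Filter (nbhs (z : Cplx R)) by exact: nbhs_filter.
apply/(cvgrPdist_lt (FF := FF)) => e e0; apply: filterS (near_dist_lt z e0) => w.
by rewrite -raddfB -ltcR; apply/le_lt_trans; exact: normc_ge_Re.
Qed.

Lemma continuous_Im : continuous (@complex.Im R : Cplx R -> R).
Proof.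
move=> z; have FF : Filter (nbhs (z : Cplx R)) by exact: nbhs_filter.
apply/(cvgrPdist_lt (FF := FF)) => e e0; apply: filterS (near_dist_lt z e0) => w.
by rewrite -raddfB -ltcR; apply/le_lt_trans; exact: normc_Im.
Qed.

Lemma normc_le_Re_Im z : (`|z| <= (`|complex.Re z| + `|complex.Im z|)%:C)%C.
Proof.
rewrite {1}[z]complexE rmorphD /= (le_trans (ler_normD _ _)) //.
by rewrite normrM normci mul1r !normc_def /= !expr0n /= !addr0 !sqrtr_sqr.
Qed.

Lemma continuous_complex :
  continuous ((fun u => u.1 +i* u.2)%C : R * R -> Cplx R).
Proof.
move=> u; have FF : Filter (nbhs u) by exact: nbhs_filter.
apply/(@cvgrPdist_lt _ (Cplx R) _ (nbhs u) FF) => e e0.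
(* The radius [e] is a positive element of [R[i]], hence real. *)
have eE : e = (complex.Re e)%:C%C by rewrite RRe_real // gtr0_real.
have e0' : 0 < complex.Re e / 2.
  by rewrite divr_gt0 // -ltcR -eE.
have c1 : nbhs u (fun v => `|u.1 - v.1| < complex.Re e / 2).
  exact: (@cvgr_dist_lt _ R^o _ (nbhs u) FF fst u.1 (@cvg_fst _ _ _ _ _) _ e0').
have c2 : nbhs u (fun v => `|u.2 - v.2| < complex.Re e / 2).
  exact: (@cvgr_dist_lt _ R^o _ (nbhs u) FF snd u.2 (@cvg_snd _ _ _ _ _) _ e0').
have c12 := @filterI _ _ FF _ _ c1 c2.
suff H (v : R * R) : `|u.1 - v.1| < complex.Re e / 2 /\
    `|u.2 - v.2| < complex.Re e / 2 ->
    `|(u.1 +i* u.2)%C - (v.1 +i* v.2)%C| < e by exact: (@filterS _ _ FF _ _ H c12).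
move=> [h1 h2]; apply: le_lt_trans (normc_le_Re_Im _) _.
by rewrite [ltRHS]eE ltcR [ltRHS]splitr /=; apply: ltrD.
Qed.

Lemma convex_hull_segment (A : set (Cplx R)) z w (l : R) : 0 <= l <= 1 ->
  convex_hull A z -> convex_hull A w ->
  convex_hull A ((l * complex.Re z + (1 - l) * complex.Re w) +i*
                 (l * complex.Im z + (1 - l) * complex.Im w))%C.
Proof.
move=> /andP[l0 l1] hz hw M [cM AM].
have /set_mem := cM z w (Itv01 l0 l1) (mem_set (hz _ (conj cM AM)))
  (mem_set (hw _ (conj cM AM))).
by case: z {hz} => a b; case: w {hw}.
Qed.

(** After translating [z] to the origin this is [planar_separation]; compactness of [A] turns strict
    positivity into a uniform bound [d]. *)
Lemma convex_hull_separation (A : set (Cplx R)) z :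
  compact A -> A !=set0 -> ~ convex_hull A z ->
  exists w, exists2 d : R, 0 < d & forall s, A s -> d <= complex.Re (w * (s - z)).
Proof.
move=> cA A0 nAz.
pose f (s : Cplx R) : R * R :=
  (complex.Re s - complex.Re z, complex.Im s - complex.Im z).
have re_cont : continuous (fun s : Cplx R => complex.Re s - complex.Re z).
  exact: (continuous_subr_cst continuous_Re).
have im_cont : continuous (fun s : Cplx R => complex.Im s - complex.Im z).
  exact: (continuous_subr_cst continuous_Im).
have f_cont : continuous f by exact: (continuous_pair re_cont im_cont).
pose H := [set u : R * R |
  convex_hull A ((u.1 + complex.Re z) +i* (u.2 + complex.Im z))%C].
have [m mP] : exists m : R * R, forall s, (f @` A) s -> 0 < m.1 * s.1 + m.2 * s.2.
  apply: (@planar_separation _ _ H).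
  - exact: continuous_compact (continuous_subspaceT f_cont) cA.
  - by have [a Aa] := A0; exists (f a), a.
  - move=> _ [a Aa <-]; by rewrite /H /= !subrK; apply: sub_gen_smallest; case: a Aa.
  - move=> u v l Hu Hv l01; have := convex_hull_segment l01 Hu Hv.
    rewrite /H /=; congr (convex_hull _ (Complex _ _)); ring.
  - by rewrite /H /= !add0r; case: (z) nAz.
pose g (s : Cplx R) : R :=
  m.1 * (complex.Re s - complex.Re z) + m.2 * (complex.Im s - complex.Im z).
have g_cont : {within A, continuous g}.
  apply: continuous_subspaceT.
  exact: (continuous_linear2 re_cont im_cont).
have [c cA' gmin] := compact_EVT_min A0 cA g_cont.
(* Multiplying by the conjugate of [m] and taking the real part gives the inner product with [m]. *)
exists (m.1 -i* m.2)%C, (g c).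
  by apply: (mP (f c)); exists c => //; exact: set_mem.
move=> s As; have := gmin _ (mem_set As); rewrite /g.
case: s {As} => a b; case: (z) => a' b' /=; lra.
Qed.

End ComplexPlane.

(** * Integration against a compactly supported measure *)

Section Support.
Variables (R : realType) (mu : {measure set (BorelC R) -> \bar R}).

Lemma openC_measurable (U : set (Cplx R)) : open U ->
  measurable (U : set (BorelC R)).
Proof. by move=> oU; exact: sub_sigma_algebra. Qed.

Lemma continuous_measurableC (f : Cplx R -> R) : continuous f ->
  measurable_fun setT (f : BorelC R -> R).
Proof.
move=> /continuousP cf; apply: (measurability _ (RGenOpens.measurableE R)).
move=> _ [_ [a [b ->] <-]]; rewrite setTI; apply: openC_measurable.
exact/cf/interval_open.
Qed.

Lemma open_msupportC : open (~` msupport mu).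
Proof.
rewrite openE => z /= /existsNP[U /not_implyP[[oU Uz] muU]].
apply: (@filterS _ (nbhs z) (nbhs_filter z) U); last exact: open_nbhs_nbhs.
by move=> w Uw /= /(_ U (conj oU Uw)).
Qed.

Lemma measurable_msupport : measurable (msupport mu : set (BorelC R)).
Proof.
by have := measurableC (openC_measurable open_msupportC); rewrite setCK.
Qed.

(** A countable base of the plane, needed to cover the complement of the support by countably many
    null sets. *)
Definition rational_box (q : (rat * rat) * (rat * rat)) : set (Cplx R) :=
  [set z | ratr q.1.1 < complex.Re z < ratr q.1.2 /\
           ratr q.2.1 < complex.Im z < ratr q.2.2].

Lemma open_rational_box q : open (rational_box q).
Proof.
have -> : rational_box q =
    (@complex.Re R) @^-1` `]ratr q.1.1, ratr q.1.2[%classic `&`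
    (@complex.Im R) @^-1` `]ratr q.2.1, ratr q.2.2[%classic.
  by apply/seteqP; split => z; rewrite /rational_box /= !in_itv.
have /continuousP cR := @continuous_Re R; have /continuousP cI := @continuous_Im R.
by apply: openI; [apply: cR|apply: cI]; exact: interval_open.
Qed.

Lemma rational_box_sub (U : set (Cplx R)) z : open U -> U z ->
  exists2 q, rational_box q z & rational_box q `<=` U.
Proof.
move=> oU Uz; have /nbhs_ballP[e /= e0 eU] : nbhs z U by exact: open_nbhs_nbhs.
have eE : e = (complex.Re e)%:C%C by rewrite RRe_real // gtr0_real.
set r := complex.Re e in eE.
have r0 : 0 < r / 2 by rewrite divr_gt0 // -ltcR -eE.
have lo (a : R) : a - r / 2 < a by rewrite ltrBlDr ltrDl.
have hi (a : R) : a < a + r / 2 by rewrite ltrDl.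
have [q1 Q1] := rat_in_itvoo (lo (complex.Re z)).
have [q2 Q2] := rat_in_itvoo (hi (complex.Re z)).
have [q3 Q3] := rat_in_itvoo (lo (complex.Im z)).
have [q4 Q4] := rat_in_itvoo (hi (complex.Im z)).
move: Q1 Q2 Q3 Q4; rewrite !in_itv /=.
move=> /andP[a1 b1] /andP[a2 b2] /andP[a3 b3] /andP[a4 b4].
exists ((q1, q2), (q3, q4)).
  by rewrite /rational_box /= b1 a2 b3 a4.
move=> w [/= /andP[c1 c2] /andP[c3 c4]]; apply: eU.
rewrite -ball_normE /ball_ /= eE (le_lt_trans (normc_le_Re_Im _)) // ltcR.
rewrite [ltRHS]splitr !raddfB /=; apply: ltrD; rewrite ltr_norml; lra.
Qed.

(** Each point off the support has a null open neighbourhood, hence lies in a null rational box. *)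
Lemma msupportC_null : mu (~` msupport mu) = 0%E.
Proof.
apply/negligibleP.
  by apply: measurableC; exact: measurable_msupport.
(* An index that codes no box, or a box of positive measure, contributes the empty set. *)
pose B (k : nat) : set (BorelC R) :=
  if unpickle k is Some q then
    if mu (rational_box q) == 0%E then rational_box q else set0
  else set0.
have nB k : mu.-negligible (B k).
  rewrite /B; case: unpickle => [q|]; last exact: negligible_set0.
  case: eqP => [q0|_]; last exact: negligible_set0.
  by apply/negligibleP => //; apply: openC_measurable; exact: open_rational_box.
apply: negligibleS (negligible_bigcup nB).
move=> z /= /existsNP[U /not_implyP[[oU Uz] muU]].
have [q qz qU] := rational_box_sub oU Uz.
have q0 : mu (rational_box q) == 0%E.
  rewrite eq_le measure_ge0 andbT leNgt.
  apply: contra_notN muU => /lt_le_trans; apply.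
  apply: le_measure => //; rewrite inE; apply: openC_measurable => //.
  exact: open_rational_box.
have Bq : B (pickle q) = rational_box q by rewrite /B pickleK q0.
by exists (pickle q); [exact: I|rewrite Bq].
Qed.

End Support.

Section IntegrationOnSupport.
Variables (R : realType) (mu : {finite_measure set (BorelC R) -> \bar R}).
Hypothesis mu_compact : compact (msupport mu).

(** Off the support nothing is integrated, and on the compact support [f] is bounded while the
    measure is finite. *)
Lemma integrable_continuous_msupport (f : Cplx R -> R) : continuous f ->
  mu.-integrable setT (EFin \o (f : BorelC R -> R)).
Proof.
move=> cf; have mf := continuous_measurableC cf.
have mS := @measurable_msupport R mu.
apply: (proj2 (negligible_integrable (measurableC mS) measurableT _
  (msupportC_null mu))).
  exact/measurable_EFinP.
rewrite setTD setCK; apply: measurable_bounded_integrable => //.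
- by rewrite ltey_eq fin_num_measure.
- exact: measurable_funS mf.
have : bounded_set (f @` msupport mu).
  apply: compact_bounded; apply: continuous_compact => //.
  exact: continuous_subspaceT.
move=> [M [Mr HM]]; exists M; split => // N MN z Sz.
by apply: (HM N MN); exists z.
Qed.

Lemma Rintegral_msupport (f : Cplx R -> R) : continuous f ->
  Rintegral mu setT (f : BorelC R -> R) = Rintegral mu (msupport mu) f.
Proof.
move=> cf; have mS := measurableC (@measurable_msupport R mu).
rewrite /Rintegral (negligible_integral mS measurableT _ (msupportC_null mu)).
  by rewrite setTD setCK.
exact: integrable_continuous_msupport.
Qed.

Lemma Rintegral_msupport_ge0 (f : Cplx R -> R) : continuous f ->
  (forall s, msupport mu s -> 0 <= f s) ->
  0 <= Rintegral mu setT (f : BorelC R -> R).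
Proof. by move=> cf f0; rewrite Rintegral_msupport //; exact: Rintegral_ge0. Qed.

Variables (x : R[i]) (k : {nonneg R}).

Let pt := mscale k \d_(x : BorelC R).
Let mu' := measure_add mu pt.

Lemma integrable_mscale_dirac (f : Cplx R -> R) : continuous f ->
  pt.-integrable setT (EFin \o (f : BorelC R -> R)).
Proof.
move=> /continuous_measurableC mf; apply/integrableP; split.
  exact/measurable_EFinP.
rewrite ge0_integral_mscale //; last first.
  by apply: measurableT_comp => //; exact/measurable_EFinP.
rewrite integral_dirac //; last first.
  by apply: measurableT_comp => //; exact/measurable_EFinP.
by rewrite diracT mul1e -EFinM ltry.
Qed.

Lemma integral_mscale_dirac (f : Cplx R -> R) : continuous f ->
  (\int[pt]_z (f z)%:E = (k%:num * f x)%:E)%E.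
Proof.
move=> /continuous_measurableC /measurable_EFinP mf; rewrite integralE.
have mp := measurable_funepos mf; have mn := measurable_funeneg mf.
rewrite !ge0_integral_mscale //.
rewrite !integral_dirac // diracT !mul1e.
rewrite funeposE funenegE /= -!EFin_max -!EFinM; congr EFin; rewrite -mulrBr.
by congr (_ * _); rewrite /Num.max /= oppr_lt0; case: ltrgt0P; lra.
Qed.

Lemma Rintegral_add_mass (f : Cplx R -> R) : continuous f ->
  Rintegral mu' setT (f : BorelC R -> R) =
  Rintegral mu setT (f : BorelC R -> R) + k%:num * f x.
Proof.
move=> cf; rewrite /Rintegral integral_measure_add //.
- rewrite integral_mscale_dirac // fineD //.
  exact: (integrable_fin_num _ (integrable_continuous_msupport cf)).
- exact: integrable_continuous_msupport.
- exact: integrable_mscale_dirac.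
Qed.

End IntegrationOnSupport.

(** * The Hermitian form of a measure on polynomials *)

Section PolynomialForm.
Variable R : realType.

(** Continuity is stated by components because [Cintegral] integrates real and imaginary parts
    separately. *)
Definition re_im_continuous (F : BorelC R -> R[i]) :=
  continuous (fun z : Cplx R => complex.Re (F z)) /\
  continuous (fun z : Cplx R => complex.Im (F z)).

Lemma ReM (z w : R[i]) :
  complex.Re (z * w) = complex.Re z * complex.Re w - complex.Im z * complex.Im w.
Proof. by case: z; case: w. Qed.

Lemma ImM (z w : R[i]) :
  complex.Im (z * w) = complex.Re z * complex.Im w + complex.Im z * complex.Re w.
Proof. by case: z; case: w => a b c d /=; ring. Qed.

Lemma Re_conj (z : R[i]) : complex.Re z^* = complex.Re z.
Proof. by case: z. Qed.

Lemma Im_conj (z : R[i]) : complex.Im z^* = - complex.Im z.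
Proof. by case: z. Qed.

Lemma re_im_continuous_cst c : re_im_continuous (fun=> c).
Proof. by split; exact: cst_continuous. Qed.

Lemma re_im_continuousD F G : re_im_continuous F -> re_im_continuous G ->
  re_im_continuous (fun z => F z + G z).
Proof.
move=> [F1 F2] [G1 G2]; split.
- under eq_fun do rewrite raddfD /=; exact: continuous_addr.
- under eq_fun do rewrite raddfD /=; exact: continuous_addr.
Qed.

Lemma re_im_continuousM F G : re_im_continuous F -> re_im_continuous G ->
  re_im_continuous (fun z => F z * G z).
Proof.
move=> [F1 F2] [G1 G2]; split.
- under eq_fun do rewrite ReM.
  apply: continuous_addr; first exact: continuous_mulr.
  by apply: continuous_oppr; exact: continuous_mulr.
- under eq_fun do rewrite ImM.
  by apply: continuous_addr; exact: continuous_mulr.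
Qed.

Lemma re_im_continuous_conj F : re_im_continuous F ->
  re_im_continuous (fun z => (F z)^*).
Proof.
move=> [F1 F2]; split.
- by under eq_fun do rewrite Re_conj.
- by under eq_fun do rewrite Im_conj; exact: continuous_oppr.
Qed.

Lemma re_im_continuous_horner (p : {poly R[i]}) :
  re_im_continuous (fun z => p.[z]).
Proof.
elim/poly_ind: p => [|p c IHp].
  under [X in re_im_continuous X]eq_fun do rewrite horner0.
  exact: re_im_continuous_cst.
under [X in re_im_continuous X]eq_fun do rewrite hornerMXaddC.
apply: re_im_continuousD; last exact: re_im_continuous_cst.
apply: re_im_continuousM => //; split; [exact: continuous_Re|exact: continuous_Im].
Qed.

Section Cintegral.
Variables (mu : {finite_measure set (BorelC R) -> \bar R}).
Hypothesis mu_compact : compact (msupport mu).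

Lemma CintegralD F G : re_im_continuous F -> re_im_continuous G ->
  Cintegral mu (fun z => F z + G z) = Cintegral mu F + Cintegral mu G.
Proof.
move=> [F1 F2] [G1 G2]; rewrite /Cintegral.
under eq_Rintegral do rewrite raddfD /=.
under [X in (_ +i* X)%C]eq_Rintegral do rewrite raddfD /=.
rewrite !RintegralD //; exact: integrable_continuous_msupport.
Qed.

Lemma CintegralZ c F : re_im_continuous F ->
  Cintegral mu (fun z => c * F z) = c * Cintegral mu F.
Proof.
move=> [F1 F2]; rewrite /Cintegral.
have i1 := integrable_continuous_msupport mu_compact F1.
have i2 := integrable_continuous_msupport mu_compact F2.
under eq_Rintegral do rewrite ReM.
under [X in (_ +i* X)%C]eq_Rintegral do rewrite ImM.
have iZ (a : R) (f : Cplx R -> R) : continuous f ->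
    mu.-integrable setT (EFin \o (fun z : BorelC R => a * f z)).
  move=> cf.
  apply: (integrable_continuous_msupport mu_compact (f := fun z => a * f z)).
  by apply: continuous_mulr => //; exact: cst_continuous.
rewrite RintegralB ?RintegralD ?RintegralZl //; try exact: iZ.
by case: c.
Qed.

Lemma Cintegral_conj F : re_im_continuous F ->
  Cintegral mu (fun z => (F z)^*) = (Cintegral mu F)^*.
Proof.
move=> [F1 F2]; rewrite /Cintegral.
have i2 := integrable_continuous_msupport mu_compact F2.
under eq_Rintegral do rewrite Re_conj.
under [X in (_ +i* X)%C]eq_Rintegral do rewrite Im_conj -mulN1r.
by rewrite RintegralZl // mulN1r.
Qed.

Lemma Re_Cintegral_ge0 F : re_im_continuous F ->
  (forall s, msupport mu s -> 0 <= complex.Re (F s)) ->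
  0 <= complex.Re (Cintegral mu F).
Proof. by move=> [F1 _] F0; exact: Rintegral_msupport_ge0. Qed.

Lemma Cintegral_add_mass F x (k : {nonneg R}) : re_im_continuous F ->
  Cintegral (measure_add mu (mscale k \d_(x : BorelC R))) F =
  Cintegral mu F + (k%:num)%:C%C * F x.
Proof.
move=> [F1 F2]; rewrite /Cintegral !Rintegral_add_mass //.
by case: (F x) => a b; apply/eqP; rewrite eq_complex /= !mul0r subr0 addr0 !eqxx.
Qed.

Definition poly_form (f g : {poly R[i]}) : R[i] :=
  Cintegral mu (fun z => (f.[z])^* * g.[z]).

Let cont (f g : {poly R[i]}) : re_im_continuous (fun z => (f.[z])^* * g.[z]).
Proof.
apply: re_im_continuousM; last exact: re_im_continuous_horner.
exact/re_im_continuous_conj/re_im_continuous_horner.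
Qed.

Lemma poly_formD f g h : poly_form f (g + h) = poly_form f g + poly_form f h.
Proof.
rewrite /poly_form -CintegralD //; congr Cintegral; apply/funext => z.
by rewrite hornerD mulrDr.
Qed.

Lemma poly_formZ c f g : poly_form f (c *: g) = c * poly_form f g.
Proof.
rewrite /poly_form -CintegralZ //; congr Cintegral; apply/funext => z.
by rewrite hornerZ mulrCA.
Qed.

Lemma poly_formC f g : poly_form g f = (poly_form f g)^*.
Proof.
rewrite /poly_form -Cintegral_conj //; congr Cintegral; apply/funext => z.
by rewrite rmorphM /= conjCK mulrC.
Qed.

(** Hermitian symmetry makes the value real, and the real part of the integrand is [|f|^2]. *)
Lemma poly_form_ge0 f : 0 <= poly_form f f.
Proof.
have := poly_formC f f; case E : (poly_form f f) => [a b] /eqP.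
rewrite eq_complex /= eqxx /= => /eqP b0.
rewrite lecE /= eq_sym; apply/andP; split; first by apply/eqP; lra.
have -> : a = complex.Re (poly_form f f) by rewrite E.
apply: Re_Cintegral_ge0 => // s _.
by rewrite ReM Re_conj Im_conj mulNr opprK addr_ge0 // -expr2 sqr_ge0.
Qed.

(** Integrating [Re (w (s - z)) |f(s)|^2 >= d |f(s)|^2] bounds the real part of [w I] from below,
    and the modulus dominates the real part. *)
Lemma poly_form_shift_ge (w z : R[i]) (d : R) f :
  (forall s, msupport mu s -> d <= complex.Re (w * (s - z))) ->
  (d%:C%C * poly_form f f <= `|w| * `|poly_form f (('X - z%:P) * f)|).
Proof.
move=> dP; rewrite -normrM; set I := poly_form f (_ * f).
have ff_real : poly_form f f = (complex.Re (poly_form f f))%:C%C.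
  by rewrite RRe_real // ger0_real // poly_form_ge0.
have : 0 <= complex.Re (w * I - d%:C%C * poly_form f f).
  have -> : w * I - d%:C%C * poly_form f f =
      poly_form f ((w *: ('X - z%:P) - d%:C%C%:P) * f).
    rewrite mulrBl -scalerAl mul_polyC -scaleNr poly_formD !poly_formZ mulNr //.
  apply: Re_Cintegral_ge0 => // s Ss.
  have -> : f.[s]^* * ((w *: ('X - z%:P) - d%:C%C%:P) * f).[s] =
      (w * (s - z) - d%:C%C) * `|f.[s]| ^+ 2.
    rewrite hornerM hornerD hornerN hornerZ hornerXsubC hornerC normCK.
    by rewrite mulrCA [f.[s]^* * _]mulrC.
  rewrite -add_Re2_Im2 ReM /= mulr0 subr0 mulr_ge0 ?addr_ge0 ?sqr_ge0 //.
  by rewrite raddfB /= subr_ge0 dP.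
rewrite raddfB [X in _ - X]ReM /= mul0r subr0 subr_ge0 => le1.
rewrite ff_real -rmorphM (le_trans _ (normc_ge_Re _)) // lecR.
exact: le_trans le1 (ler_norm _).
Qed.

Lemma poly_form_shift_le (z : R[i]) (D : R) f : 0 <= D ->
  (forall s : R[i], msupport mu s -> `|s - z| <= D%:C%C) ->
  poly_form (('X - z%:P) * f) (('X - z%:P) * f) <= D%:C%C ^+ 2 * poly_form f f.
Proof.
move=> D0 DP; set g := ('X - z%:P) * f.
(* Both sides are real, so the inequality in [R[i]] reduces to one between real parts. *)
have real h : poly_form h h = (complex.Re (poly_form h h))%:C%C.
  by rewrite RRe_real // ger0_real // poly_form_ge0.
have : 0 <= complex.Re (D%:C%C ^+ 2 * poly_form f f - poly_form g g).
  pose F s := D%:C%C ^+ 2 * (f.[s]^* * f.[s]) + -1 * (g.[s]^* * g.[s]).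
  have -> : D%:C%C ^+ 2 * poly_form f f - poly_form g g = Cintegral mu F.
    rewrite /F CintegralD ?CintegralZ ?mulN1r //.
    - by apply: re_im_continuousM => //; exact: re_im_continuous_cst.
    - by apply: re_im_continuousM => //; exact: re_im_continuous_cst.
  apply: (@Re_Cintegral_ge0 F) => [|s Ss]; rewrite /F.
    by apply: re_im_continuousD; apply: re_im_continuousM => //;
      exact: re_im_continuous_cst.
  rewrite ![_^* * _]mulrC -!normCK.
  have : 0 <= D%:C%C ^+ 2 * `|f.[s]| ^+ 2 + -1 * `|g.[s]| ^+ 2.
    rewrite mulN1r subr_ge0 (_ : g.[s] = (s - z) * f.[s]); last first.
      by rewrite hornerM hornerXsubC.
    rewrite normrM exprMn.
    rewrite ler_wpM2r ?exprn_ge0 //.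
    by apply: lerXn2r; [exact: normr_ge0|rewrite nnegrE lecR|exact: DP].
  by rewrite lecE => /andP[].
rewrite raddfB -rmorphXn [X in X - _]ReM /= mul0r subr0 subr_ge0 => le0.
by rewrite (real f) (real g) -rmorphM lecR.
Qed.

End Cintegral.
End PolynomialForm.

(** * Convergence of the quotient *)

Section RatioEstimates.
Variables (C : numClosedFieldType) (c E : C).
Hypotheses (c_gt0 : 0 < c) (E_ge0 : 0 <= E) (cE : c ^+ 2 = 1 + E).

Let c_ge1 : 1 <= c.
Proof.
rewrite -(@ler_pXn2r _ 2) ?nnegrE ?ler01 ?(ltW c_gt0) //.
by rewrite expr1n cE lerDl.
Qed.

(** Since [c >= 1], one has [c - 1 <= (c - 1) (c + 1) = E]. It is applied with
    [a = A_n(z) / p_n(z)], and with [a = 0] at infinity. *)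
Lemma inv_ratio_dist_le (a : C) : `|1 - c^-1 * (1 + a)| <= `|a| + E.
Proof.
have cN := lt0r_neq0 c_gt0.
have -> : 1 - c^-1 * (1 + a) = c^-1 * ((c - 1) - a) by field.
rewrite normrM normfV (ger0_norm (ltW c_gt0)) ler_pdivrMl //.
apply: (@le_trans _ _ (`|a| + E)); last by rewrite ler_peMl ?addr_ge0.
rewrite (le_trans (ler_normB _ _)) // addrC lerD2l.
rewrite ger0_norm ?subr_ge0 //.
have -> : E = (c - 1) * (c + 1) by rewrite -subr_sqr cE; ring.
by rewrite ler_peMr ?subr_ge0 // lerDr (ltW c_gt0).
Qed.

(** [E = (1 - 1 / c) c (c + 1)], and [1 / c >= 1 / 2] bounds [c (c + 1)] by [2 * 4]. *)
Lemma gap_le_inv_ratio_dist (e : C) : e <= 2^-1 -> `|1 - c^-1| < e -> E <= 8 * e.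
Proof.
have cN := lt0r_neq0 c_gt0.
have s_le1 : 0 <= 1 - c^-1 by rewrite subr_ge0 invf_le1.
rewrite ger0_norm // => e_le se.
have s_ge : 2^-1 <= c^-1.
  have : 1 - c^-1 <= 2^-1 by rewrite (le_trans (ltW se)).
  by rewrite lerBlDr -lerBlDl (_ : 1 - 2^-1 = 2^-1 :> C) //; field.
have c_le2 : c <= 2 by rewrite -lef_pV2 ?posrE.
have -> : E = (1 - c^-1) * (c * (c + 1)).
  by apply: (addrI 1); rewrite -cE; field.
rewrite mulrC; apply: ler_pM => //; last exact: ltW.
  by rewrite mulr_ge0 ?addr_ge0 // ltW.
have -> : (8 : C) = 2 * 4 by ring.
apply: ler_pM; rewrite ?addr_ge0 ?(ltW c_gt0) //.
by rewrite (_ : (4 : C) = 2 + 2) ?lerD ?ler1n //; ring.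
Qed.

End RatioEstimates.

(** * Locally uniform estimates of the quotient outside the convex hull *)

Section QuotientOutsideHull.
Variables (R : realType) (mu : {finite_measure set (BorelC R) -> \bar R}).
Hypothesis mu_compact : compact (msupport mu).
Variables (x : R[i]) (t : R).
Hypothesis t_gt0 : 0 < t.
Variables p q : nat -> {poly R[i]}.
Hypothesis p_mu : is_orthonormal_polys mu p.
Hypothesis q_mu : is_orthonormal_polys
  (measure_add mu (mscale (NngNum (ltW t_gt0)) \d_(x : BorelC R))) q.

Let ip := poly_form mu.
Let c n := lead_ratio p q n.
Let E n := mass_gap p x t%:C%C n.
Let A n := low_diff p q n.

Let size_p n : size (p n) = n.+1. Proof. by have [] := p_mu.1 n. Qed.
Let size_q n : size (q n) = n.+1. Proof. by have [] := q_mu.1 n. Qed.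
Let lead_p n : 0 < lead_coef (p n). Proof. by have [] := p_mu.1 n. Qed.
Let lead_q n : 0 < lead_coef (q n). Proof. by have [] := q_mu.1 n. Qed.
Let ip_p n m : ip (p n) (p m) = (n == m)%:R. Proof. exact: p_mu.2. Qed.
Let tC_gt0 : 0 < t%:C%C. Proof. by rewrite ltcR. Qed.

Let ip_q n m :
  ip (q n) (q m) + t%:C%C * ((q n).[x]^* * (q m).[x]) = (n == m)%:R.
Proof.
rewrite -q_mu.2 Cintegral_add_mass //.
apply: re_im_continuousM; last exact: re_im_continuous_horner.
exact/re_im_continuous_conj/re_im_continuous_horner.
Qed.

Let ipD := poly_formD mu_compact.
Let ipZ := poly_formZ mu_compact.
Let ipC := poly_formC mu_compact.
Let ip_ge0 := poly_form_ge0 mu_compact.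

Let E_ge0 n : 0 <= E n. Proof. exact: mass_gap_ge0. Qed.
Let c_gt0 n : 0 < c n. Proof. exact: lead_ratio_gt0. Qed.
Let cE n : c n ^+ 2 = 1 + E n.
Proof. exact: (lead_ratio_sqr ipD ipZ ipC). Qed.

(** The vector [w] is not normalized: dividing by the bound [W] of its modulus puts [d / W] in the
    place of the separation constant. *)
Lemma low_diff_quotient_le (z w : R[i]) (d D W : R) :
    0 < d -> 0 <= D -> 0 < W -> `|w| <= W%:C%C ->
    (forall s, msupport mu s -> d <= complex.Re (w * (s - z))) ->
    (forall s : R[i], msupport mu s -> `|s - z| <= D%:C%C) -> forall n,
  (p n).[z] != 0 /\
  `|(A n).[z] / (p n).[z]| ^+ 2 <= (D * W / d)%:C%C ^+ 2 * E n.
Proof.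
move=> d0 D0 W0 wW sep bd n.
have dW0 : 0 < (d / W)%:C%C :> R[i] by rewrite ltcR divr_gt0.
have DC0 : 0 <= D%:C%C :> R[i] by rewrite lecR.
have hge f : (d / W)%:C%C * ip f f <= `|ip f (('X - z%:P) * f)|.
  rewrite mulrC rmorphM fmorphV /= mulrA ler_pdivrMr ?ltcR //.
  rewrite mulrC (le_trans (poly_form_shift_ge mu_compact f sep)) //.
  by rewrite mulrC ler_wpM2l.
have hle f := poly_form_shift_le mu_compact f D0 bd.
have pz := orthonormal_horner_neq0 ipD ipZ ipC ip_ge0 size_p ip_p dW0 hge n.
split => //.
have := horner_low_bound ipD ipZ ipC ip_ge0 size_p ip_p dW0 DC0 hge hle
  (size_low_diff size_p size_q lead_q n).
have pz2 : 0 < `|(p n).[z]| ^+ 2 by rewrite exprn_gt0 ?normr_gt0.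
have dW2 : 0 < (d / W)%:C%C ^+ 2 :> R[i] by rewrite exprn_gt0.
rewrite -/(A n) -/ip => H.
rewrite normrM normfV exprMn exprVn ler_pdivrMr // -(ler_pM2l dW2).
apply: (le_trans H).
have -> : (d / W)%:C%C ^+ 2 * ((D * W / d)%:C%C ^+ 2 * E n * `|(p n).[z]| ^+ 2) =
    D%:C%C ^+ 2 * (`|(p n).[z]| ^+ 2 * E n).
  rewrite -!rmorphXn mulrA mulrA -rmorphM /=.
  have -> : (d / W) ^+ 2 * (D * W / d) ^+ 2 = D ^+ 2.
    by field; rewrite !gt_eqF.
  by ring.
rewrite ler_wpM2l ?exprn_ge0 // ler_wpM2l ?exprn_ge0 //.
exact: (ip_low_diff_le ipD ipZ ipC).
Qed.

Hypothesis mu_neq0 : msupport mu !=set0.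

Lemma msupport_bounded : exists2 M : R, 1 <= M &
  forall s : R[i], msupport mu s -> `|s| <= M%:C%C.
Proof.
pose f (s : Cplx R) := complex.Re s * complex.Re s + complex.Im s * complex.Im s.
have cf : continuous f.
  by apply: continuous_addr; apply: continuous_mulr;
    [exact: continuous_Re|exact: continuous_Re|
     exact: continuous_Im|exact: continuous_Im].
have [m _ fm] := compact_EVT_max mu_neq0 mu_compact (continuous_subspaceT cf).
have fm0 : 0 <= f m by rewrite /f -!expr2 addr_ge0 ?sqr_ge0.
(* With [f m] the maximum of [|s|^2] on the support, [|s|^2 <= f m <= (1 + f m)^2]. *)
exists (1 + f m) => [|s Ss]; first by rewrite lerDl.
have m0 : 0 <= (1 + f m)%:C%C :> R[i] by rewrite lecR addr_ge0.
rewrite -(@ler_pXn2r _ 2) ?nnegrE ?normr_ge0 //.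
rewrite -add_Re2_Im2 -rmorphXn lecR !expr2.
have : f s <= f m by apply: fm; rewrite inE.
by rewrite /f => /le_trans; apply; rewrite -/(f m); nra.
Qed.

(** [B] serves for all [n] at once. At infinity nothing is asked, since the quotient there is
    [1 / c_n] and does not involve [A_n]. *)
Definition quotient_bounded (B : R) (y : Csphere R) : Prop :=
  if y is Some z then forall n, (p n).[z] != 0 /\
    `|(A n).[z] / (p n).[z]| ^+ 2 <= B%:C%C ^+ 2 * E n
  else True.

(** Near a finite point [z], the separating [w] of [z] still works with [d / 2]. Near infinity,
    [w = - conj(z')] works, because [Re (w (s - z')) = |z'|^2 - Re (conj(z') s)]. *)
Lemma near_quotient_bounded (y : Csphere R) :
  ~ (Some @` convex_hull (msupport mu)) y ->
  exists2 B : R, 0 <= B & \forall y' \near y, quotient_bounded B y'.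
Proof.
have [M M_ge1 MP] := msupport_bounded.
have M_gt0 : 0 < M by exact: lt_le_trans M_ge1.
case: y => [z|] hy.
  have nz : ~ convex_hull (msupport mu) z by move=> hz; apply: hy; exists z.
  have [w [d d_gt0 sep]] := convex_hull_separation mu_compact mu_neq0 nz.
  pose V : R := complex.Re `|w|.
  have wV : `|w| = V%:C%C by rewrite RRe_real // ger0_real.
  have V_ge0 : 0 <= V by rewrite -ler0c -wV.
  pose N : R := complex.Re `|z|.
  have zN : `|z| = N%:C%C by rewrite RRe_real // ger0_real.
  have N_ge0 : 0 <= N by rewrite -ler0c -zN.
  pose W := V + 1; have W_gt0 : 0 < W by rewrite /W; lra.
  (* For [|z - z'| < r] the term [w (z - z')] has modulus at most [d / 2]. *)
  pose r := d / 2 / W.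
  have d2_gt0 : 0 < d / 2 by rewrite divr_gt0.
  have r_gt0 : 0 < r by apply: divr_gt0.
  pose D := M + N + r; have D_ge0 : 0 <= D by rewrite /D; lra.
  exists (D * W / (d / 2)); first by rewrite divr_ge0 ?mulr_ge0 // ltW.
  suff H z' : (`|z - z'| < r%:C)%C -> quotient_bounded (D * W / (d / 2)) (Some z').
    exact: (@filterS _ (nbhs (z : Cplx R)) (nbhs_filter (z : Cplx R)) _ _ H
      (near_dist_lt z r_gt0)).
  move=> zz'; apply: (@low_diff_quotient_le z' w) => //.
  - by rewrite wV lecR lerDl.
  - move=> s Ss.
    have -> : w * (s - z') = w * (s - z) + w * (z - z') by ring.
    rewrite raddfD /=.
    have := sep _ Ss.
    have : `|complex.Re (w * (z - z'))| <= d / 2.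
      rewrite -lecR (le_trans (normc_ge_Re _)) // normrM.
      apply: (@le_trans _ _ (W%:C%C * r%:C%C)).
        by apply: ler_pM => //; [rewrite wV lecR lerDl|exact: ltW].
      by rewrite -rmorphM lecR /r mulrC divfK // gt_eqF.
    by rewrite ler_norml => /andP[]; lra.
  - move=> s Ss; have -> : s - z' = s - z + (z - z') by ring.
    rewrite (le_trans (ler_normD _ _)) // /D rmorphD lerD //; last exact: ltW.
    rewrite (le_trans (ler_normB _ _)) // rmorphD lerD //; exact: MP.
(* For [N = |z'| > 2 M], take the distance bound [2 N], the bound [N] of [|w|] and the separation
   [N^2 / 2]; then [(2 N) N / (N^2 / 2) = 4]. *)
exists 4 => //.
pose L := 2 * M.
(* The complement of this compact square, with infinity, is the neighbourhood; its finite points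
   have modulus greater than [L]. *)
pose K := ((fun u => u.1 +i* u.2)%C : R * R -> Cplx R) @`
  (`[- L, L]%classic `*` `[- L, L]%classic).
have K_compact : compact K.
  apply: continuous_compact; first exact/continuous_subspaceT/continuous_complex.
  by apply: compact_setX; exact: segment_compact.
have K_closed : closed K by apply: compact_closed => //; exact: norm_hausdorff.
exists K => // -[z|//] [[z' nK [<-]]|//] {z}.
pose N : R := complex.Re `|z'|.
have zN : `|z'| = N%:C%C by rewrite RRe_real // ger0_real.
have N_gt : L < N.
  rewrite ltNge; apply/negP => NL; apply: nK.
  exists (complex.Re z', complex.Im z'); last by case: (z').
  rewrite /= !in_itv /= -!ler_norml -!lecR.
  split; [apply: le_trans (normc_ge_Re _) _|apply: le_trans (normc_Im _) _].
    by rewrite zN lecR.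
  by rewrite zN lecR.
have N_gt0 : 0 < N by rewrite (lt_trans _ N_gt) // mulr_gt0.
have H : forall n, (p n).[z'] != 0 /\
    `|(A n).[z'] / (p n).[z']| ^+ 2 <= ((2 * N) * N / (N ^+ 2 / 2))%:C%C ^+ 2 * E n.
  apply: (@low_diff_quotient_le z' (- z'^*)) => //.
  - by rewrite divr_gt0 // exprn_gt0.
  - by rewrite mulr_ge0 // ltW.
  - by rewrite normrN norm_conjC zN.
  - move=> s Ss.
    have -> : - z'^* * (s - z') = (N ^+ 2)%:C%C + - (z'^* * s).
      by rewrite rmorphXn /= -zN normCK; ring.
    rewrite raddfD /=.
    have : `|complex.Re (- (z'^* * s))| <= N * M.
      rewrite -lecR (le_trans (normc_ge_Re _)) // normrN normrM norm_conjC zN rmorphM.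
      by apply: ler_wpM2l; [rewrite ler0c ltW|exact: MP].
    by rewrite ler_norml => /andP[]; rewrite /L in N_gt; nra.
  - move=> s Ss; rewrite (le_trans (ler_normB _ _)) // zN.
    rewrite (le_trans (lerD (MP _ Ss) (lexx _))) // -rmorphD lecR.
    by rewrite /L in N_gt; lra.
move=> n; have := H n.
by have -> : (2 * N) * N / (N ^+ 2 / 2) = 4 by field; rewrite gt_eqF.
Qed.


Lemma poly_ratio_dist_le (B : R) (y : Csphere R) n : quotient_bounded B y ->
  exists2 a : R[i], `|a| ^+ 2 <= B%:C%C ^+ 2 * E n &
    (`|1 - (poly_ratio (q n) (p n) y : R[i])| <= `|a| + E n).
Proof.
have cN : c n != 0 by rewrite gt_eqF.
case: y => [z|] /= hy; last first.
  exists 0; first by rewrite normr0 expr0n /= mulr_ge0 // -rmorphXn ler0c sqr_ge0.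
  have := inv_ratio_dist_le (c_gt0 n) (E_ge0 n) (cE n) 0.
  by rewrite addr0 mulr1 /c /lead_ratio invf_div.
have [pz az] := hy n; exists ((A n).[z] / (p n).[z]) => //.
have -> : (q n).[z] / (p n).[z] = (c n)^-1 * (1 + (A n).[z] / (p n).[z]).
  have -> : (A n).[z] = c n * (q n).[z] - (p n).[z].
    by rewrite /A /low_diff hornerD hornerN hornerZ.
  by field; rewrite cN pz.
exact: inv_ratio_dist_le.
Qed.

Lemma inv_lead_ratio_gap n (e : R[i]) : e <= 2^-1 ->
  `|1 - (poly_ratio (q n) (p n) None : R[i])| < e -> E n <= 8 * e.
Proof.
rewrite /= -invf_div => e_le.
exact: (gap_le_inv_ratio_dist (c_gt0 n) (E_ge0 n) (cE n)).
Qed.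

(** * The two implications *)

Let F n := `|(p n).[x]| ^+ 2 / (\sum_(j < n) `|(p j).[x]| ^+ 2).

Lemma ratio_at_infinity_cvg :
  (fun n => poly_ratio (q n) (p n) None) @ \oo --> (1 : Cplx R) ->
  (F : nat -> Cplx R) @ \oo --> (0 : Cplx R).
Proof.
move=> cv; apply/(@cvgrPdist_lt _ (Cplx R)) => e e0.
(* The constant of [le_mass_gap]. *)
pose M := 1 + (t%:C%C * christoffel_sum p x 1)^-1.
have M_gt0 : 0 < M.
  by rewrite ltr_wpDr // invr_ge0 mulr_ge0 ?christoffel_sum_ge0 // ltW.
(* Small enough both for [dl <= 1 / 2], which [inv_lead_ratio_gap] requires, and for
   [8 M dl <= e / 2]. *)
pose dl := (2 + 16 * M / e)^-1.
have Me_gt0 : 0 < 16 * M / e by rewrite divr_gt0 // mulr_gt0.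
have dl_gt0 : 0 < dl by rewrite invr_gt0 addr_gt0.
have dl_le : dl <= 2^-1.
  by rewrite lef_pV2 ?posrE ?addr_gt0 // lerDl ltW.
have dl_e : M * (8 * dl) <= e / 2.
  have : dl <= (16 * M / e)^-1 by rewrite lef_pV2 ?posrE ?addr_gt0 // lerDr.
  rewrite -(ler_pM2l (_ : 0 < M * 8)) ?mulr_gt0 // mulrA => /le_trans; apply.
  rewrite (_ : M * 8 * (16 * M / e)^-1 = e / 2) //.
  by field; rewrite !gt_eqF.
have near_dl : \forall n \near \oo,
    `|1 - (poly_ratio (q n) (p n) None : R[i])| < dl.
  exact: (@cvgr_dist_lt _ (Cplx R) _ _ _ _ _ cv _ dl_gt0).
apply: filterS (filterI near_dl (nbhs_infty_gt 0)) => n [Hn n_gt0].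
have En := inv_lead_ratio_gap dl_le Hn.
have F_ge0 : 0 <= F n.
  by rewrite divr_ge0 ?exprn_ge0 // christoffel_sum_ge0.
rewrite sub0r normrN (ger0_norm F_ge0).
apply: (@le_lt_trans _ _ (e / 2)); last by rewrite ltr_pdivrMr // ltr_pMr // ltr1n.
apply: le_trans dl_e; apply: le_trans (le_mass_gap size_p x tC_gt0 n_gt0) _.
by rewrite ler_wpM2l // ltW.
Qed.

Lemma ratio_uniform_cvg (K : set (Csphere R)) :
  compact K -> K `<=` ~` (Some @` convex_hull (msupport mu)) ->
  (F : nat -> Cplx R) @ \oo --> (0 : Cplx R) ->
  {uniform K, (fun n => poly_ratio (q n) (p n)) @ \oo -->
    (cst 1 : Csphere R -> Cplx R)}.
Proof.
move=> cK hK cv.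
have E0 (e : R[i]) : 0 < e -> \forall n \near \oo, E n < e.
  move=> e0; have near_e : \forall n \near \oo, `|0 - F n| < e.
    exact: (@cvgr_dist_lt _ (Cplx R) _ _ _ _ _ cv _ e0).
  apply: filterS (filterI near_e (nbhs_infty_gt 0)) => n [+ n_gt0].
  rewrite sub0r normrN; apply: le_lt_trans.
  apply: le_trans (mass_gap_le size_p x tC_gt0 n_gt0) _.
  apply/real_ler_norm/ger0_real/divr_ge0; first exact: exprn_ge0.
  exact: christoffel_sum_ge0.
move=> P /uniform_nbhs[U [entU UP]].
have [e /= e0 eU] : exists2 e : R[i], 0 < e &
    [set y : Cplx R * Cplx R | ball y.1 e y.2] `<=` U.
  by move: entU; rewrite -entourage_ballE.
have e2 : 0 < e / 2 by rewrite divr_gt0.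
suff H : \forall n \near \oo, K `<=`
    (fun y => `|1 - (poly_ratio (q n) (p n) y : R[i])| < e).
  apply: filterS H => n Hn; apply: UP => y Ky; apply: eU => /=.
  by rewrite -ball_normE; exact: Hn.
(* By compactness it suffices to find, around each point of [K], a neighbourhood on which the
   estimate holds for all large [n]. *)
apply: ((compact_near_coveringP K).1 cK) => y Ky.
have [B B0 nearB] := near_quotient_bounded (hK y Ky).
have BC : 0 <= B%:C%C :> R[i] by rewrite ler0c.
(* [E n < d] gives [B^2 E_n <= (e / 2)^2]; the added [1] keeps the denominator positive when
   [B = 0]. *)
pose d := (e / 2) ^+ 2 / (B%:C%C ^+ 2 + 1).
have B1 : 0 < B%:C%C ^+ 2 + 1 by rewrite ltr_wpDl // exprn_ge0.
have d0 : 0 < d by rewrite divr_gt0 // exprn_gt0.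
exists (quotient_bounded B, [set n | E n < e / 2 /\ E n < d]).
  split => //=.
  exact: filterI (E0 _ e2) (E0 _ d0).
move=> [y' n] [/= By [En1 En2]].
have [a a2 ratio] := poly_ratio_dist_le n By.
apply: le_lt_trans ratio _; rewrite [ltRHS]splitr ler_ltD //.
rewrite -(@ler_pXn2r _ 2) ?nnegrE ?(ltW e2) // (le_trans a2) //.
apply: (@le_trans _ _ ((B%:C%C ^+ 2 + 1) * d)); last by rewrite mulrC divfK ?gt_eqF.
by apply: ler_pM; rewrite ?exprn_ge0 ?lerDl // ltW.
Qed.

End QuotientOutsideHull.

Theorem mainTheorem7 (R : realType)
    (mu : {finite_measure set (BorelC R) -> \bar R})
    (mu_compact : compact (msupport mu))
    (mu_infinite : infinite_set (msupport mu))
    (x : R[i]) (t : R) (t_gt0 : 0 < t)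
    (p q : nat -> {poly R[i]})
    (p_mu : is_orthonormal_polys mu p)
    (q_mu : is_orthonormal_polys
              (measure_add mu (mscale (NngNum (ltW t_gt0)) \d_(x : BorelC R))) q) :
  (forall K : set (Csphere R),
     compact K -> K `<=` ~` (Some @` convex_hull (msupport mu)) ->
     {uniform K, (fun n => poly_ratio (q n) (p n)) @ \oo --> (cst 1 : Csphere R -> Cplx R)})
  <->
  (fun n => `|(p n).[x]| ^+ 2 / (\sum_(j < n) `|(p j).[x]| ^+ 2) : Cplx R)
    @ \oo --> (0 : Cplx R).
Proof.
have mu_neq0 : msupport mu !=set0.
  by apply/set0P/eqP => mu0; apply: mu_infinite; rewrite mu0; exact: finite_set0.
split=> [H|H K cK hK].
  apply: (ratio_at_infinity_cvg mu_compact p_mu q_mu).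
  (* The compact set consisting of infinity alone is admissible, and uniform convergence on it is
     convergence of [1 / c_n]. *)
  have HN : [set (None : Csphere R)] `<=` ~` (Some @` convex_hull (msupport mu)).
    by move=> _ -> [].
  by have := H _ (@compact_set1 _ (None : Csphere R)) HN; rewrite uniform_set1.
exact: (ratio_uniform_cvg mu_compact p_mu q_mu mu_neq0).
Qed.
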